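(* Let $m\in\mathbb N$ and let $(X^1_t)_{t\in[0,\infty)},\dots,(X^m_t)_{t\in[0,\infty)}$ be processes adapted to a common filtration $(\mathcal A_t)_{t\in[0,\infty)}$, with Doob-Meyer decompositions $$X_t^i=X_0^i+M_t^i+\int_0^tY_s^i\,dV_s,\qquad i=1,\dots,m,$$ where each $(M^i_t)_{t}$ is a zero mean martingale and $(V_t)_{t\in[0,\infty)}$ is an increasing process not depending on $i$. Assume that for each $i$ the process $(Y^i_t)_{t\in[0,\infty)}$ is non-increasing in $t$. Put $X_t=\sum_{i=1}^mX^i_t$. Then: (i) The stopping problem for $(X_t)_{t\in[0,\infty)}$ is a monotone case problem, with myopic rule $$\tau^*=\inf\Big\{t:\ \sum_{i=1}^mY^i_t\leq 0\Big\}.$$ (ii) If $$\lim_{L\to\infty}EX_{\min\{\tau^*,L\}}\leq EX_{\tau^*}\qquad\text{and}\qquad \sup\{EX_\tau:\tau\text{ a bounded stopping time}\}=\sup_\tau EX_\tau ,$$ then $\tau^*$ is optimal, i.e. $EX_{\tau^*}=\sup_\tau EX_\tau$.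
   Context: All stopping times are with respect to $(\mathcal A_t)_{t\in[0,\infty)}$, take values in $[0,\infty]$ (not necessarily finite a.s.), and $X_\infty:=\liminf_{t\to\infty}X_t$. The supremum $\sup_\tau EX_\tau$ is over all stopping times $\tau$ for which $EX_\tau$ exists. The usual regularity assumptions are in force (integrable processes with right-continuous paths, right-continuous martingales, well-defined integrals, first entrance times being stopping times). For a process with Doob-Meyer decomposition $X_t=X_0+M_t+\int_0^tY_s\,dV_s$, with $(M_t)$ a zero mean martingale and $(V_t)$ increasing, the myopic stopping time (infinitesimal look ahead rule) is $\tau^*=\inf\{t:Y_t\leq0\}$, with $\inf\emptyset=\infty$; the stopping problem for $X$ is called a monotone case problem if $Y_t\leq 0$ for all $t>\tau^*$.
   Formalization: Part (ii) additionally assumes that at every time t>0 either V or each Y^i is left-continuous (automatic for continuous V); without it (ii) fails, e.g. m=1, M=0, X_0=0, V_t=1_{t≥1}, Y_t=1 for t<1 and −1 for t≥1, where τ*=1 gives −1<0. *)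

(* Defs.v *)
From HB Require Import structures.
From mathcomp Require Import all_boot all_order all_algebra.
From mathcomp Require Import all_classical all_reals all_analysis.
From mathcomp Require Import measurable_realfun.
Set Implicit Arguments.
Unset Strict Implicit.
Unset Printing Implicit Defensive.
Import Order.TTheory GRing.Theory Num.Theory.
Import numFieldNormedType.Exports.
Local Open Scope classical_set_scope.
Local Open Scope ring_scope.

(* The time set [0, oo) is the set of t : R with 0 <= t: a process is a
   function R -> T -> R whose values at negative times are never used.
   Equalities between random variables are almost sure; properties of paths
   (right-continuity, monotonicity) hold for every w. *)

Section processes.
Context {d : measure_display} {T : measurableType d} {R : realType}.
Implicit Types (P : probability T R) (A : R -> set (set T)).
Implicit Types (G : set (set T)) (X M Y : R -> T -> R) (V : T -> cumulative R R).

Definition filtration A : Prop :=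
  (forall t, 0 <= t -> sigma_algebra setT (A t) /\ A t `<=` measurable) /\
  (forall s t, 0 <= s -> s <= t -> A s `<=` A t).

Definition measurable_wrt G (f : T -> R) : Prop :=
  forall B : set R, measurable B -> G (f @^-1` B).

Definition adapted A X : Prop := forall t, 0 <= t -> measurable_wrt (A t) (X t).

Definition right_continuous_paths X : Prop :=
  forall w t, 0 <= t -> X s w @[s --> t^'+] --> X t w.

Definition process A P X : Prop :=
  [/\ adapted A X,
      forall t, 0 <= t -> P.-integrable setT (EFin \o X t) &
      right_continuous_paths X].

(* [g] is a version of the conditional expectation of [f] given [G]. *)
Definition is_cond_expectation P G (f g : T -> R) : Prop :=
  [/\ measurable_wrt G g, P.-integrable setT (EFin \o g) &
      forall B, G B -> (\int[P]_(w in B) (g w)%:E = \int[P]_(w in B) (f w)%:E)%E].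

Definition martingale A P M : Prop :=
  process A P M /\
  forall s t, 0 <= s -> s <= t -> is_cond_expectation P (A s) (M t) (M s).

Definition zero_mean P M : Prop := forall t, 0 <= t -> ('E_P[M t] = 0)%E.

(* An increasing process is given by its paths [V w : cumulative R R], i.e.
   right-continuous and nondecreasing functions. They are defined on all of R,
   but only the restriction of [V w] to [0, oo) matters: the integral over
   `]0, t] depends on nothing else, and a nondecreasing right-continuous
   function on [0, oo) extends to R by its value at 0. *)
Definition increasing_process A V : Prop := adapted A (fun t w => V w t).

(* The Lebesgue-Stieltjes integral \int_0^t Y_s dV_s, taken over `]0, t]. *)
Definition path_integral Y V (t : R) (w : T) : R :=
  \int[lebesgue_stieltjes_measure (V w)]_(s in `]0, t]) Y s w.

Definition well_defined_integral Y V (t : R) (w : T) : Prop :=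
  (lebesgue_stieltjes_measure (V w)).-integrable `]0, t]
    (fun s => (Y s w)%:E).

Definition doob_meyer A P X M Y V : Prop :=
  [/\ process A P X,
      martingale A P M /\ zero_mean P M,
      adapted A Y,
      increasing_process A V &
      {ae P, forall w, forall t, 0 <= t ->
        well_defined_integral Y V t w /\
        X t w = X 0 w + M t w + path_integral Y V t w}].

(* If V jumps at t, the integrand is left-continuous at t; void when V is
   continuous. *)
Definition left_continuous_at_jumps Y V : Prop :=
  forall w t, 0 < t ->
    V w s @[s --> t^'-] --> V w t \/ Y s w @[s --> t^'-] --> Y t w.

Local Open Scope ereal_scope.
Implicit Type tau : T -> \bar R.

Definition stopping_time A tau : Prop :=
  (forall w, 0 <= tau w) /\
  (forall t : R, (0 <= t)%R -> A t [set w | tau w <= t%:E]).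

Definition bounded_time tau : Prop := exists L : R, forall w, tau w <= L%:E.

Definition at_infinity X (w : T) : \bar R :=
  limf_einf (fun t => (X t w)%:E) (pinfty_nbhs R).

Definition stopped X tau (w : T) : \bar R :=
  if tau w is t%:E then (X t w)%:E else at_infinity X w.

Definition mean_stopped P X tau : \bar R := \int[P]_w stopped X tau w.

Definition mean_exists P X tau : Prop :=
  measurable_fun [set: T] (stopped X tau) /\
  (\int[P]_w (stopped X tau)^\+ w < +oo \/
   \int[P]_w (stopped X tau)^\- w < +oo).

Definition sup_mean A P X : \bar R :=
  ereal_sup [set mean_stopped P X tau | tau in
    [set tau | stopping_time A tau /\ mean_exists P X tau]].

Definition sup_mean_bounded A P X : \bar R :=
  ereal_sup [set mean_stopped P X tau | tau in
    [set tau | [/\ stopping_time A tau, bounded_time tau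
                 & mean_exists P X tau]]].

Definition optimal A P X tau : Prop :=
  [/\ stopping_time A tau, mean_exists P X tau &
      mean_stopped P X tau = sup_mean A P X].

(* The infimum of the empty set is +oo. *)
Definition myopic_time Y (w : T) : \bar R :=
  ereal_inf [set t%:E | t in [set t : R | (0 <= t)%R /\ (Y t w <= 0)%R]].

Definition monotone_case A P X M Y V : Prop :=
  doob_meyer A P X M Y V /\
  forall w (t : R), (0 <= t)%R -> myopic_time Y w < t%:E -> (Y t w <= 0)%R.

End processes.

(* Main.v *)
(* By the decomposition X = X_0 + M + I with I_t the integral of Y dV. Since Y is
   non-increasing, I increases up to the myopic time tau and decreases after
   it, so pathwise I_sigma <= I_(tau /\ L) for every stopping time sigma <= L.
   Optional stopping removes the martingale part: E X_sigma <= E X_(tau /\ L),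
   where the right-hand side is nondecreasing in L and may be +oo. The first
   hypothesis of (ii) lets L tend to infinity, the second one passes from
   bounded to arbitrary stopping times.

   Optional stopping is obtained by discretising sigma from above. For
   U = M_(L + 1) and Z_n the value of M at the discretised time,
   E[(U - Z_n) g(Z_n)] = 0 for every bounded g. Choosing g such that x g(x) is
   bounded, dominated convergence replaces Z_n by its limit M_sigma; then g is
   let tend to 1. This avoids uniform integrability. *)
Require Import Defs.
From mathcomp Require Import all_boot all_order all_algebra.
From mathcomp Require Import all_classical all_reals all_analysis.
From mathcomp Require Import measurable_realfun.
From mathcomp Require Import ring lra.
Set Implicit Arguments.
Unset Strict Implicit.
Unset Printing Implicit Defensive.
Import Order.TTheory GRing.Theory Num.Theory.
Import numFieldNormedType.Exports.
Local Open Scope classical_set_scope.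
Local Open Scope ring_scope.

(** * Measurability with respect to a sub-sigma-algebra, and finite sums *)

Section sub_sigma_algebra_measurability.
Context {d : measure_display} {T : measurableType d} {R : realType}.
Implicit Types (G : set (set T)) (f g : T -> R).

(** The sets generated by a sigma-algebra [G] are those of [G], so the closure properties of
    measurable functions become available for [measurable_wrt G]. *)
Lemma measurable_wrtP G f : sigma_algebra setT G ->
  measurable_wrt G f <-> measurable_fun [set: g_sigma_algebraType G] f.
Proof.
move=> sG; rewrite /measurable_fun /measurable_wrt; split => [h _ B mB|h B mB].
  by rewrite setTI; apply: sub_sigma_algebra; exact: h.
by have := h measurableT B mB; rewrite setTI /measurable /= sigma_algebra_id.
Qed.

Lemma measurable_wrt_fun G f : G `<=` measurable ->
  measurable_wrt G f -> measurable_fun setT f.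
Proof. by move=> Gm h _ B mB; rewrite setTI; exact/Gm/h. Qed.

Lemma measurable_wrt_sum G (m : nat) (f : 'I_m -> T -> R) :
  sigma_algebra setT G -> (forall i, measurable_wrt G (f i)) ->
  measurable_wrt G (fun w => \sum_(i < m) f i w).
Proof.
move=> sG mf; apply/measurable_wrtP => //; apply: measurable_sum => i.
exact/measurable_wrtP.
Qed.

Lemma EFin_comp_sum (m : nat) (f : 'I_m -> T -> R) :
  EFin \o (fun w => \sum_(i < m) f i w) = (fun w => \sum_(i < m) (f i w)%:E)%E.
Proof. by apply/funext => w /=; rewrite sumEFin. Qed.

Lemma integrable_sumr (mu : {measure set T -> \bar R}) D (m : nat)
    (f : 'I_m -> T -> R) : measurable D ->
  (forall i, mu.-integrable D (EFin \o f i)) ->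
  mu.-integrable D (EFin \o (fun w => \sum_(i < m) f i w)).
Proof.
move=> mD If; rewrite EFin_comp_sum.
by apply: integrable_sum => // i _; exact: If.
Qed.

Lemma integral_sumr (mu : {measure set T -> \bar R}) D (m : nat)
    (f : 'I_m -> T -> R) : measurable D ->
  (forall i, mu.-integrable D (EFin \o f i)) ->
  (\int[mu]_(w in D) (\sum_(i < m) f i w)%R%:E
    = \sum_(i < m) \int[mu]_(w in D) (f i w)%:E)%E.
Proof.
move=> mD If; rewrite -integral_sum//.
by apply: eq_integral => w _; rewrite sumEFin.
Qed.

Lemma Rintegral_sumr (mu : {measure set T -> \bar R}) D (m : nat)
    (f : 'I_m -> T -> R) : measurable D ->
  (forall i, mu.-integrable D (EFin \o f i)) ->
  \int[mu]_(w in D) (\sum_(i < m) f i w) = \sum_(i < m) \int[mu]_(w in D) f i w.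
Proof.
move=> mD If; rewrite /Rintegral integral_sumr// -sum_fine// => i _.
by apply: integrable_fin_num => //; exact: If.
Qed.

End sub_sigma_algebra_measurability.

(** * Sums of Doob-Meyer decompositions with a common integrator *)

Section sums_of_processes.
Context {d : measure_display} {T : measurableType d} {R : realType}.
Variables (P : probability T R) (A : R -> set (set T)) (m : nat).
Hypothesis filtrationA : filtration A.
Implicit Types (X M Y : 'I_m -> R -> T -> R) (V : T -> cumulative R R).

Lemma adapted_sum X : (forall i, adapted A (X i)) ->
  adapted A (fun t w => \sum_(i < m) X i t w).
Proof.
move=> aX t t0; have [/(_ t t0)[sA _] _] := filtrationA.
by apply: measurable_wrt_sum => // i; exact: aX.
Qed.

Lemma process_sum X : (forall i, process A P (X i)) ->
  process A P (fun t w => \sum_(i < m) X i t w).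
Proof.
move=> pX; split.
- by apply: adapted_sum => i; have [] := pX i.
- by move=> t t0; apply: integrable_sumr => // i; have [_ /(_ t t0)] := pX i.
- move=> w t t0; apply: cvg_big => [|i _]; first exact: add_continuous.
  by have [_ _ /(_ w t t0)] := pX i.
Qed.

Lemma martingale_sum M : (forall i, martingale A P (M i)) ->
  martingale A P (fun t w => \sum_(i < m) M i t w).
Proof.
move=> mM; split; first by apply: process_sum => i; have [] := mM i.
move=> s t s0 st; have [/(_ s s0)[sA Am] _] := filtrationA.
split.
- by apply: measurable_wrt_sum => // i; have [_ /(_ s t s0 st)[]] := mM i.
- by apply: integrable_sumr => // i; have [_ /(_ s t s0 st)[]] := mM i.
- move=> B AB; have mB := Am _ AB.
  rewrite !integral_sumr//.
  + by apply: eq_bigr => i _; have [_ /(_ s t s0 st)[_ _ ->]] := mM i.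
  + move=> i; apply: (integrableS measurableT) => //.
    by have [[_ + _] _] := mM i; apply; rewrite (le_trans s0).
  + move=> i; apply: (integrableS measurableT) => //.
    by have [[_ + _] _] := mM i; apply.
Qed.

Lemma doob_meyer_sum X M Y V : (0 < m)%N ->
  (forall i, doob_meyer A P (X i) (M i) (Y i) V) ->
  doob_meyer A P (fun t w => \sum_(i < m) X i t w)
    (fun t w => \sum_(i < m) M i t w) (fun t w => \sum_(i < m) Y i t w) V.
Proof.
move=> m0 dm; split.
- by apply: process_sum => i; have [] := dm i.
- split; first by apply: martingale_sum => i; have [_ []] := dm i.
  move=> t t0; rewrite unlock integral_sumr//; last first.
    by move=> i; have [_ [[[_ + _] _] _] _ _ _] := dm i; apply.
  by apply: big1 => i _; have [_ [_ /(_ t t0)]] := dm i; rewrite unlock.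
- by apply: adapted_sum => i; have [] := dm i.
(* The integrator is shared, so any single index supplies its adaptedness; [0 < m] provides one. *)
- by have [] := dm (Ordinal m0).
(* The finitely many exceptional null sets are merged into one before the decompositions are
   added. *)
- have : {ae P, forall w, forall i t, 0 <= t ->
      well_defined_integral (Y i) V t w /\
      X i t w = X i 0 w + M i t w + path_integral (Y i) V t w}.
    by apply: filter_forall => i; have [] := dm i.
  apply: filterS => w h t t0.
  have mI : measurable `]0, t]%classic by exact: measurable_itv.
  split.
    by apply: integrable_sumr => // i; have [] := h i t t0.
  rewrite /path_integral Rintegral_sumr//; last first.
    by move=> i; have [] := h i t t0.
  by rewrite -!big_split; apply: eq_bigr => i _; have [_] := h i t t0.
Qed.

End sums_of_processes.

(** * From vanishing integrals over events to orthogonality to bounded functions *)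

Section orthogonality.
Context {d : measure_display} {T : measurableType d} {R : realType}.
Variable P : probability T R.
Implicit Types (G : set (set T)) (W U Z h : T -> R).

Lemma integrableM_bounded (W h : T -> R) (c : R) :
  P.-integrable setT (EFin \o W) -> measurable_fun setT h ->
  (forall w, `|h w| <= c) ->
  P.-integrable setT (EFin \o (fun w => W w * h w)).
Proof.
move=> IW mh hc.
have -> : EFin \o (fun w => W w * h w) = ((EFin \o W) \* (EFin \o h))%E.
  by apply/funext => w /=; rewrite EFinM.
apply: integrableMl => //; exists c; split; first exact: num_real.
by move=> b cb w _; exact: le_trans (hc w) (ltW cb).
Qed.

Lemma integrableBr (f g : T -> R) :
  P.-integrable setT (EFin \o f) -> P.-integrable setT (EFin \o g) ->
  P.-integrable setT (EFin \o (fun w => f w - g w)).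
Proof. by move=> If Ig; exact: (integrableB measurableT If Ig). Qed.

Lemma measurable_integrable (f : T -> R) :
  P.-integrable setT (EFin \o f) -> measurable_fun setT f.
Proof. by move=> /measurable_int/measurable_EFinP. Qed.

(** With [N = n + 1], the sum counts the integers from 1 to [N] that are at most [x * N], so it is
    the integer part of [x * N]; the error is the fractional part divided by [N]. *)
Lemma step_approximation (n : nat) (x : R) : 0 <= x <= 1 ->
  `|x - n.+1%:R^-1 * \sum_(j < n.+1) (j.+1%:R <= x * n.+1%:R)%R%:R| <= n.+1%:R^-1.
Proof.
move=> /andP[x0 x1]; set N : R := n.+1%:R.
have N0 : 0 < N by rewrite ltr0n.
have xN0 : 0 <= x * N by rewrite mulr_ge0// ltW.
set k := Num.truncn (x * N).
have kn : (k <= n.+1)%N.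
  rewrite -(ler_nat R) (@le_trans _ _ (x * N)) ?truncn_le//.
    by rewrite -/N -[leRHS]mul1r ler_wpM2r// ltW.
have -> : \sum_(j < n.+1) (j.+1%:R <= x * N)%R%:R = k%:R :> R.
  rewrite -natr_sum; congr (_%:R).
  transitivity (\sum_(j < n.+1 | (j < k)%N) 1)%N.
    rewrite [RHS]big_mkcond; apply: eq_bigr => j _.
    by rewrite -truncn_gt_nat; case: ifP.
  by rewrite (big_ord_narrow kn) big_const_ord iter_addn mul1n addn0.
have /andP[k1 k2] := truncn_itv xN0; rewrite -/k in k1 k2.
have -> : x - N^-1 * k%:R = N^-1 * (x * N - k%:R).
  by rewrite mulrBr mulrCA mulVf ?mulr1// gt_eqF.
rewrite normrM gtr0_norm ?invr_gt0// ler_piMr ?invr_ge0 ?(ltW N0)//.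
rewrite ger0_norm ?subr_ge0// lerBlDl natr1 ltW//.
Qed.

Lemma Rintegral_mul_indic W B : measurable B ->
  \int[P]_w (W w * \1_B w) = \int[P]_(w in B) W w.
Proof.
move=> mB; rewrite [RHS]Rintegral_mkcond; apply: eq_Rintegral => w _.
by rewrite patchE indicE; case: ifP => _; rewrite ?mulr1 ?mulr0.
Qed.

(** [h] is uniformly within [1 / (n + 1)] of an average of indicators of its level sets [E n j].
    These lie in [G], so each indicator is orthogonal to [W], and the integral of [W * h] is at most
    [E |W| / (n + 1)] in absolute value. *)
Lemma Rintegral_orthogonal_unit G W h :
  sigma_algebra setT G -> G `<=` measurable ->
  P.-integrable setT (EFin \o W) ->
  (forall B, G B -> \int[P]_(w in B) W w = 0) ->
  measurable_wrt G h -> (forall w, 0 <= h w <= 1) ->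
  \int[P]_w (W w * h w) = 0.
Proof.
move=> sG Gm IW W0 mh h01.
have hm := measurable_wrt_fun Gm mh.
pose step n w : R := n.+1%:R^-1 *
  \sum_(j < n.+1) (j.+1%:R <= h w * n.+1%:R)%R%:R.
pose E n j := h @^-1` `[j.+1%:R / n.+1%:R, +oo[%classic.
have GE n j : G (E n j) by apply: mh; exact: measurable_itv.
have stepE n w : W w * step n w =
    \sum_(j < n.+1) W w * \1_(E n j) w * n.+1%:R^-1.
  rewrite /step mulrCA mulr_sumr mulr_sumr; apply: eq_bigr => j _.
  rewrite mulrC; congr (_ * _ * _); rewrite indicE; congr ((nat_of_bool _)%:R).
  by rewrite /E; apply/idP/idP; rewrite inE /= in_itv /= andbT ler_pdivrMr// ltr0n.
have Iterm n j :
    P.-integrable setT (EFin \o (fun w => W w * \1_(E n j) w)).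
  apply: (@integrableM_bounded _ _ 1) => //.
    by apply: measurable_indic; exact: Gm.
  by move=> w; rewrite indicE; case: (_ \in _); rewrite ?normr1 ?normr0.
have Iterm' n j :
    P.-integrable setT (EFin \o (fun w => W w * \1_(E n j) w * n.+1%:R^-1)).
  by apply: (@integrableM_bounded _ (cst n.+1%:R^-1) `|n.+1%:R^-1|).
have Istep n : P.-integrable setT (EFin \o (fun w => W w * step n w)).
  by rewrite (funext (stepE n)); exact: integrable_sumr.
have step0 n : \int[P]_w (W w * step n w) = 0.
  under eq_Rintegral do rewrite stepE.
  rewrite Rintegral_sumr//; apply: big1 => j _.
  rewrite RintegralZr// Rintegral_mul_indic ?W0 ?mul0r//; exact: Gm.
have IWh : P.-integrable setT (EFin \o (fun w => W w * h w)).
  apply: (@integrableM_bounded _ _ 1) => // w.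
  by have /andP[h0 h1] := h01 w; rewrite ger0_norm.
have IWn := integrable_norm IW.
set C := \int[P]_w `|W w|.
have bound n : `|\int[P]_w (W w * h w)| <= C / n.+1%:R.
  rewrite -[X in `|X|]subr0 -(step0 n) -RintegralB//.
  apply: (le_trans (le_normr_Rintegral _ _)) => //.
    exact: integrableBr.
  rewrite -RintegralZr//; apply: le_Rintegral => //.
  - by apply: integrable_norm; exact: integrableBr.
  - by apply: (@integrableM_bounded _ (cst n.+1%:R^-1) `|n.+1%:R^-1|).
  - move=> w _; rewrite -mulrBr normrM ler_wpM2l//.
    exact: step_approximation.
apply/eqP; rewrite -normr_le0; apply/ler_addgt0Pl => e e0; rewrite addr0.
have C0 : 0 <= C by apply: Rintegral_ge0.
pose n := Num.truncn (C / e).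
apply: le_trans (bound n) _.
rewrite ler_pdivrMr ?ltr0n// mulrC -ler_pdivrMr//.
by apply: ltW; exact: truncnS_gt.
Qed.

(** An affine map takes [[-1, 1]] to [[0, 1]]; the constant it adds is orthogonal to [W] because
    [setT] belongs to [G]. *)
Lemma Rintegral_orthogonal G W h :
  sigma_algebra setT G -> G `<=` measurable ->
  P.-integrable setT (EFin \o W) ->
  (forall B, G B -> \int[P]_(w in B) W w = 0) ->
  measurable_wrt G h -> (forall w, `|h w| <= 1) ->
  \int[P]_w (W w * h w) = 0.
Proof.
move=> sG Gm IW W0 mh h1.
have hm := measurable_wrt_fun Gm mh.
pose k w := 2^-1 * (h w + 1).
have k01 w : 0 <= k w <= 1.
  by have := h1 w; rewrite /k ler_norml => /andP[? ?]; apply/andP; split; lra.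
have mk : measurable_wrt G k.
  apply/measurable_wrtP => //; apply: measurable_funM => //.
  by apply: measurable_funD => //; exact/measurable_wrtP.
have Wk := Rintegral_orthogonal_unit sG Gm IW W0 mk k01.
have IWk : P.-integrable setT (EFin \o (fun w => W w * k w)).
  apply: (@integrableM_bounded _ _ 1) => //; first exact: measurable_wrt_fun mk.
  by move=> w; have /andP[? ?] := k01 w; rewrite ger0_norm.
have IWk2 : P.-integrable setT (EFin \o (fun w => W w * k w * 2)).
  by apply: (@integrableM_bounded _ (cst 2) `|2|).
have -> : \int[P]_w (W w * h w) = \int[P]_w (W w * k w * 2 - W w).
  by apply: eq_Rintegral => w _; rewrite /k; lra.
rewrite RintegralB// RintegralZr// Wk W0 ?mul0r ?subrr//.
by have [s0 sC _] := sG; rewrite -(setD0 setT); exact: sC.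
Qed.

End orthogonality.

(** * Limits of conditional expectations without uniform integrability *)

Section limit_of_conditional_expectations.
Context {d : measure_display} {T : measurableType d} {R : realType}.
Variable P : probability T R.
Implicit Types (U Z f : T -> R).

Lemma Rintegral_limit0 (f_ : nat -> T -> R) f (b : T -> R) :
  (forall n, measurable_fun setT (f_ n)) ->
  (forall w, f_ n w @[n --> \oo] --> f w) ->
  P.-integrable setT (EFin \o b) ->
  (forall n w, `|f_ n w| <= b w) ->
  (forall n, \int[P]_w f_ n w = 0) -> \int[P]_w f w = 0.
Proof.
move=> mf cf Ib fb f0.
have mlim : measurable_fun setT f.
  by apply: (@measurable_fun_cvg _ _ _ _ f_) => // w _; exact: cf.
have If n : P.-integrable setT (EFin \o f_ n).
  apply: (le_integrable measurableT _ _ Ib); first exact/measurable_EFinP.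
  by move=> w _ /=; rewrite lee_fin (le_trans (fb n w))// ler_norm.
have f0E n : (\int[P]_w (f_ n w)%:E = 0)%E.
  rewrite -[LHS](fineK (integrable_fin_num measurableT (If n))).
  exact: (congr1 EFin (f0 n)).
have [] := @dominated_convergence _ _ _ P setT measurableT
  (fun n => EFin \o f_ n) (EFin \o f) (EFin \o b).
- by move=> n; exact/measurable_EFinP.
- exact/measurable_EFinP.
- by apply: aeW => w _ /=; apply: cvg_EFin; [exact: nearW|exact: cf].
- exact: Ib.
- by apply: aeW => w n _ /=; rewrite lee_fin.
move=> _ _ /=; rewrite (_ : (fun n => _) = cst 0%E); last first.
  by apply/funext => n; exact: f0E.
by rewrite /Rintegral => /cvg_lim <-//; rewrite lim_cst.
Qed.

(* [U - Z] is orthogonal to every bounded function of [Z], i.e. [Z] is a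
   version of the conditional expectation of [U] given [Z] itself. *)
Definition orthogonal_residual U Z := forall g : R -> R,
  measurable_fun setT g -> (forall x, `|g x| <= 1) ->
  \int[P]_w ((U w - Z w) * g (Z w)) = 0.

(* Unlike [x], the product [x * damp c x] is bounded; and [damp c] tends to 1. *)
Definition damp (c : nat) (x : R) : R := c.+1%:R / (c.+1%:R + `|x|).

Lemma damp_den_gt0 c (x : R) : 0 < c.+1%:R + `|x|.
Proof. by rewrite ltr_wpDr// ltr0n. Qed.

Lemma damp_ge0 c x : 0 <= damp c x.
Proof. by rewrite divr_ge0// ltW// damp_den_gt0. Qed.

Lemma damp_le1 c x : `|damp c x| <= 1.
Proof.
by rewrite ger0_norm ?damp_ge0// ler_pdivrMr ?damp_den_gt0// mul1r lerDl.
Qed.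

Lemma norm_mul_damp c x : `|x| * damp c x <= c.+1%:R.
Proof.
rewrite /damp mulrA ler_pdivrMr ?damp_den_gt0// mulrC ler_wpM2l//.
by rewrite lerDr.
Qed.

Lemma continuous_damp c : continuous (damp c).
Proof.
move=> x; apply: cvgM; first exact: cvg_cst.
apply: cvgV; first by rewrite gt_eqF// damp_den_gt0.
by apply: cvgD; [exact: cvg_cst|exact: cvg_norm].
Qed.

Lemma damp_cvg1 x : damp c x @[c --> \oo] --> (1 : R).
Proof.
have -> : (fun c => damp c x) = (fun c => (1 + `|x| * harmonic c)^-1).
  apply/funext => c; rewrite /damp /harmonic /=.
  have := damp_den_gt0 c x; have : (0 : R) < c.+1%:R by rewrite ltr0n.
  by move=> c0 cx0; field; rewrite !gt_eqF.
rewrite -[X in _ --> X]invr1; apply: cvgV; first exact: oner_neq0.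
rewrite -[X in _ --> X]addr0 -(mulr0 `|x|); apply: cvgD; first exact: cvg_cst.
by apply: cvgM; [exact: cvg_cst|exact: cvg_harmonic].
Qed.

(** Testing against the sign function gives [E |Z| = E (Z g(Z)) = E (U g(Z)) <= E |U|]. *)
Lemma orthogonal_residual_L1 U Z :
  P.-integrable setT (EFin \o U) -> P.-integrable setT (EFin \o Z) ->
  orthogonal_residual U Z ->
  (\int[P]_w `|Z w|%:E <= \int[P]_w `|U w|%:E)%E.
Proof.
move=> IU IZ UZ.
pose g (x : R) : R := 2 * \1_(`[0, +oo[%classic : set R) x - 1.
have gE x : g x = if 0 <= x then 1 else -1.
  rewrite /g indicE mem_setE in_itv /= andbT; case: ifP => _ /=; lra.
have mg : measurable_fun setT g.
  by apply: measurable_funB => //; exact: measurable_funM.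
have g1 x : `|g x| <= 1 by rewrite gE; case: ifP; rewrite ?normrN normr1.
have mgZ : measurable_fun setT (g \o Z).
  by apply: measurableT_comp => //; exact: (measurable_integrable IZ).
have IUg : P.-integrable setT (EFin \o (fun w => U w * g (Z w))).
  exact: (@integrableM_bounded _ _ _ _ _ _ 1).
have IZg : P.-integrable setT (EFin \o (fun w => Z w * g (Z w))).
  exact: (@integrableM_bounded _ _ _ _ _ _ 1).
have := UZ g mg g1.
have -> : \int[P]_w ((U w - Z w) * g (Z w)) =
    \int[P]_w (U w * g (Z w) - Z w * g (Z w)).
  by apply: eq_Rintegral => w _; rewrite mulrBl.
rewrite RintegralB// => /eqP; rewrite subr_eq0 => /eqP UgZg.
have -> : (\int[P]_w `|Z w|%:E = \int[P]_w (Z w * g (Z w))%:E)%E.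
  apply: eq_integral => w _; congr (_%:E); rewrite gE.
  case: ifPn => [z0|]; first by rewrite ger0_norm// mulr1.
  by rewrite -ltNge => /ltW z0; rewrite ler0_norm// mulrN1.
have -> : (\int[P]_w (Z w * g (Z w))%:E = \int[P]_w (U w * g (Z w))%:E)%E.
  by rewrite -[LHS]fineK ?integrable_fin_num// -[RHS]fineK ?integrable_fin_num//;
     congr (_%:E).
apply: le_integral => //; first exact: (integrable_norm IU).
move=> w _; rewrite lee_fin (le_trans (ler_norm _))// normrM.
by rewrite -[leRHS]mulr1 ler_wpM2l.
Qed.

Lemma orthogonal_residual_limit U (Z_ : nat -> T -> R) Z :
  P.-integrable setT (EFin \o U) ->
  (forall n, P.-integrable setT (EFin \o Z_ n)) ->
  (forall n, orthogonal_residual U (Z_ n)) ->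
  (forall w, Z_ n w @[n --> \oo] --> Z w) ->
  P.-integrable setT (EFin \o Z) /\ \int[P]_w Z w = \int[P]_w U w.
Proof.
move=> IU IZ_ UZ cZ.
have mU := measurable_integrable IU.
have mZ_ n := measurable_integrable (IZ_ n).
have mZ : measurable_fun setT Z.
  by apply: (@measurable_fun_cvg _ _ _ _ Z_) => // w _; exact: cZ.
(* Fatou's lemma, with the bound [E |Z_ n| <= E |U|] that is uniform in [n]. *)
have IZ : P.-integrable setT (EFin \o Z).
  apply/integrableP; split; first exact/measurable_EFinP.
  have mn n : measurable_fun setT (fun w => `|Z_ n w|%:E).
    by apply/measurable_EFinP; exact: measurableT_comp.
  have n0 n w : setT w -> (0 <= `|Z_ n w|%:E)%E by rewrite lee_fin.
  have /integrable_norm/integrable_lty/= Uoo := IU.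
  have := fatou P measurableT mn n0.
  have -> : (\int[P]_w limn_einf (fun n => `|Z_ n w|%:E)
      = \int[P]_w `|(EFin \o Z) w|)%E.
    apply: eq_integral => w _ /=.
    have cw : `|Z_ n w|%:E @[n --> \oo] --> `|Z w|%:E.
      by apply: cvg_EFin; [exact: nearW|apply: cvg_norm; exact: cZ].
    rewrite is_cvg_limn_einfE; first exact/cvg_lim.
    by apply/cvg_ex; exists `|Z w|%:E.
  move=> /le_lt_trans; apply.
  apply: le_lt_trans (Uoo measurableT); rewrite limn_einf_lim.
  apply: lime_le; first exact: is_cvg_einfs.
  apply: nearW => n; apply: le_trans (orthogonal_residual_L1 IU (IZ_ n) (UZ n)).
  by apply: ereal_inf_lbound; exists n => /=.
split => //.
have mdampR c : measurable_fun setT (damp c).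
  by apply: continuous_measurable_fun; exact: continuous_damp.
have mdamp c f : measurable_fun setT f -> measurable_fun setT (damp c \o f).
  by move=> mf; exact: measurableT_comp.
(* First [n] tends to infinity with [c] fixed. The dominating function [|U| + (c + 1)] adds the
   bound on [U * damp c (Z_ n)] to the one on [Z_ n * damp c (Z_ n)]. *)
have limZ c : \int[P]_w ((U w - Z w) * damp c (Z w)) = 0.
  apply: (@Rintegral_limit0 (fun n w => (U w - Z_ n w) * damp c (Z_ n w)) _
      (fun w => `|U w| + c.+1%:R)).
  - move=> n; apply: measurable_funM; last exact: mdamp.
    exact: measurable_funB.
  - move=> w; apply: cvgM.
      by apply: cvgB; [exact: cvg_cst|exact: cZ].
    by apply: continuous_cvg; [exact: continuous_damp|exact: cZ].
  - have Ic := finite_measure_integrable_cst P c.+1%:R (@measurableT _ T).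
    exact: (integrableD measurableT (integrable_norm IU) Ic).
  - move=> n w; rewrite normrM mulrC.
    have d0 := damp_ge0 c (Z_ n w); have d1 := damp_le1 c (Z_ n w).
    have d2 := norm_mul_damp c (Z_ n w).
    rewrite (le_trans (ler_wpM2l _ (ler_normB _ _)))// mulrDr lerD//.
      by rewrite -[leRHS]mul1r ler_wpM2r.
    by rewrite ger0_norm// mulrC.
  - by move=> n; apply: UZ; [exact: mdampR|exact: damp_le1].
(* Now [c] tends to infinity; [|U - Z|] dominates, being integrable since [Z] is. *)
have UZ0 : \int[P]_w (U w - Z w) = 0.
  apply: (@Rintegral_limit0 (fun c w => (U w - Z w) * damp c (Z w)) _
      (fun w => `|U w - Z w|)).
  - by move=> c; apply: measurable_funM; [exact: measurable_funB|exact: mdamp].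
  - move=> w; rewrite -[X in _ --> X]mulr1.
    by apply: cvgM; [exact: cvg_cst|exact: damp_cvg1].
  - by apply: integrable_norm; exact: integrableBr.
  - by move=> c w; rewrite normrM -[leRHS]mulr1 ler_wpM2l ?damp_le1.
  - exact: limZ.
by move/eqP: UZ0; rewrite RintegralB// subr_eq0 => /eqP.
Qed.

End limit_of_conditional_expectations.

(** * Rounding up to a grid of mesh [1 / (n + 1)] *)

Section grid.
Context {R : realType}.
Implicit Types (n k : nat) (x : R).

(** For [x >= 0] the ceiling is nonnegative, and the absolute value only makes it a natural
    number. *)
Definition grid_index n x : nat := `|Num.ceil (x * n.+1%:R)|%N.

(** For [x >= 0], the least multiple of [1 / (n + 1)] that is at least [x]. Rounding up preserves
    stopping times and approaches [x] from the right. *)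
Definition grid_point n x : R := (grid_index n x)%:R / n.+1%:R.

Lemma grid_index_le n k x : 0 <= x ->
  (grid_index n x <= k)%N = (x <= k%:R / n.+1%:R).
Proof.
move=> x0; rewrite ler_pdivlMr ?ltr0n// -lez_nat gez0_abs.
  by rewrite ceil_le_int.
by rewrite ceil_ge0 (lt_le_trans (ltrN10 _))// mulr_ge0.
Qed.

Lemma grid_point_ge n x : 0 <= x -> x <= grid_point n x.
Proof. by move=> x0; rewrite -grid_index_le. Qed.

Lemma grid_point_lt n x : 0 <= x -> grid_point n x < x + n.+1%:R^-1.
Proof.
move=> x0; have := grid_index_le n _ x0; rewrite /grid_point.
case: (grid_index n x) => [_|k /(_ k)].
  by rewrite mul0r ltr_wpDl// invr_gt0 ltr0n.
rewrite ltnn => /esym/negbT; rewrite -ltNge => kx.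
by rewrite -natr1 mulrDl mul1r ltrD2r.
Qed.

Lemma cvg_grid_point (f : R -> R) x : 0 <= x ->
  f s @[s --> x^'+] --> f x -> f (grid_point n x) @[n --> \oo] --> f x.
Proof.
move=> x0 fx B Bfx; have [e /= e0 He] := fx B Bfx.
have [N _ HN] : \forall n \near \oo, (n.+1%:R^-1 : R) < e.
  by apply: (cvgr_lt 0) => //; exact: cvg_harmonic.
exists N => // n Nn /=; have := grid_point_ge n x0.
(* The filter [x^'+] says nothing about [x] itself, so the case where [x] is a grid point is treated
   apart. *)
rewrite le_eqVlt => /predU1P[<-|xg]; first exact: nbhs_singleton.
apply: He => //=; rewrite ltr0_norm ?subr_lt0// opprB ltrBlDl.
apply: (lt_trans (grid_point_lt n x0)); rewrite ltrD2l.
exact: HN.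
Qed.

End grid.

(** * Measurability of discretised times and of values at a random time *)

Section grid_events.
Context {d : measure_display} {T : measurableType d} {R : realType}.
Implicit Types (s : T -> R) (A : R -> set (set T)).

Lemma setD_sigma_algebra (G : set (set T)) B C : sigma_algebra setT G ->
  G B -> G C -> G (B `\` C).
Proof.
move=> sG GB GC; rewrite -(sigma_algebra_id sG).
by apply: (@measurableD _ (g_sigma_algebraType G));
  exact: sub_sigma_algebra.
Qed.

(** The event is a difference of sublevel sets of [s] at two consecutive grid times, or the single
    set [s <= 0] when [k = 0]. The later of these times is [k / (n + 1)], so the discretised time is
    again a stopping time. *)
Lemma grid_index_event A s n k : filtration A -> (forall w, 0 <= s w) ->
  (forall t, 0 <= t -> A t [set w | s w <= t]) ->
  A (k%:R / n.+1%:R) [set w | grid_index n (s w) = k].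
Proof.
move=> [FA subA] s0 As; have k0 j : 0 <= j%:R / n.+1%:R :> R by rewrite divr_ge0.
have le_event j : [set w | (grid_index n (s w) <= j)%N]
    = [set w | s w <= j%:R / n.+1%:R].
  by apply/seteqP; split => w /=; rewrite grid_index_le.
case: k => [|k].
  rewrite [X in A _ X](_ : _ = [set w | s w <= 0%:R / n.+1%:R]); last first.
    by rewrite -le_event; apply/seteqP; split => w /=; rewrite leqn0 => /eqP.
  exact: As.
rewrite [X in A _ X](_ : _ = [set w | s w <= k.+1%:R / n.+1%:R] `\`
    [set w | s w <= k%:R / n.+1%:R]); last first.
  rewrite -!le_event; apply/seteqP; split => w /=.
    by move=> ->; split => //; rewrite ltnn.
  by move=> [a /negP]; rewrite -ltnNge => b; apply/eqP; rewrite eqn_leq a.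
have [sA _] := FA _ (k0 k.+1).
apply: setD_sigma_algebra => //; first exact: As.
apply: (subA (k%:R / n.+1%:R)) => //; last exact: As.
by rewrite ler_wpM2r// ler_nat.
Qed.

(** By right-continuity the value at [s] is the limit of the values at the grid points, and each of
    these is patched together from countably many fixed times. *)
Lemma measurable_fun_at_time (X : R -> T -> R) s :
  (forall t, 0 <= t -> measurable_fun setT (X t)) ->
  right_continuous_paths X ->
  (forall w, 0 <= s w) -> (forall t, 0 <= t -> measurable [set w | s w <= t]) ->
  measurable_fun setT (fun w => X (s w) w).
Proof.
move=> mX cX s0 ms.
apply: (@measurable_fun_cvg _ _ _ _ (fun n w => X (grid_point n (s w)) w)).
  move=> n _ B mB; rewrite setTI [X in measurable X](_ : _ =
    \bigcup_k ([set w | grid_index n (s w) = k] `&`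
               X (k%:R / n.+1%:R) @^-1` B)); last first.
    apply/seteqP; split => w /=; first by move=> h; exists (grid_index n (s w)).
    by move=> [k _ [<-]].
  apply: bigcup_measurable => k _; apply: measurableI.
    (* The constant filtration of all measurable sets turns the measurable time [s] into a stopping
       time. *)
    apply: (@grid_index_event (fun=> measurable) s n k) => //.
    split => [t _|//]; last by move=> t u _ _; exact: subset_refl.
    by split; [exact: sigma_algebra_measurable|exact: subset_refl].
  by rewrite -[X in measurable X]setTI; apply: mX => //; rewrite divr_ge0.
by move=> w _; apply: (@cvg_grid_point _ (X ^~ w)); [exact: s0|exact: cX].
Qed.

End grid_events.

(** * Optional stopping at bounded stopping times *)

Section optional_stopping.
Context {d : measure_display} {T : measurableType d} {R : realType}.
Variables (P : probability T R) (A : R -> set (set T)) (M : R -> T -> R).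
Hypothesis filtrationA : filtration A.
Hypothesis martingaleM : martingale A P M.

Let integrableM t : 0 <= t -> P.-integrable setT (EFin \o M t).
Proof. by move=> t0; have [[_ + _] _] := martingaleM; apply. Qed.

Let adaptedM t : 0 <= t -> measurable_wrt (A t) (M t).
Proof. by move=> t0; have [[+ _ _] _] := martingaleM; apply. Qed.

Lemma martingale_orthogonal s t h : 0 <= s -> s <= t ->
  measurable_wrt (A s) h -> (forall w, `|h w| <= 1) ->
  \int[P]_w ((M t w - M s w) * h w) = 0.
Proof.
move=> s0 st mh h1; have [/(_ s s0)[sA Am] _] := filtrationA.
have t0 := le_trans s0 st; have IMt := integrableM t0; have IMs := integrableM s0.
apply: (Rintegral_orthogonal sA Am) => //.
  exact: integrableBr.
move=> B AB; have mB := Am _ AB; have IB := @integrableS _ _ _ P setT B.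
have [_ /(_ s t s0 st)[_ _ /(_ B AB) E]] := martingaleM.
rewrite RintegralB//; [|exact: IB|exact: IB].
by rewrite /Rintegral E subrr.
Qed.

Variables (s : T -> R) (L : R).
Hypothesis s0L : forall w, 0 <= s w <= L.
Hypothesis stopping_s : forall t, 0 <= t -> A t [set w | s w <= t].

Let s0 w : 0 <= s w. Proof. by have /andP[] := s0L w. Qed.

Let L1_ge0 : 0 <= L + 1.
Proof.
(* [T] is inhabited, so the bounds on [s] at one point give [0 <= L]. *)
have /andP[a b] := s0L point.
by rewrite addr_ge0// (le_trans a).
Qed.

Let gridM n w := M (grid_point n (s w)) w.

Let cell n k : set T := [set w | grid_index n (s w) = k].

(** The number of grid times in [[0, L + 1]]. Rounding up may exceed [L], but by less than
    [1 / (n + 1) <= 1]; hence the horizon [L + 1]. *)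
Let cells n := (Num.truncn ((L + 1) * n.+1%:R)).+1.

Let grid_time_ge0 n k : 0 <= k%:R / n.+1%:R :> R.
Proof. by rewrite divr_ge0. Qed.

Let grid_time_le n (k : 'I_(cells n)) : k%:R / n.+1%:R <= L + 1.
Proof.
rewrite ler_pdivrMr ?ltr0n// -truncn_ge_nat ?mulr_ge0//.
by rewrite -ltnS; exact: ltn_ord.
Qed.

Let cell_lt n w : (grid_index n (s w) < cells n)%N.
Proof.
rewrite ltnS truncn_ge_nat ?mulr_ge0// -ler_pdivrMr ?ltr0n//.
have /andP[_ sL] := s0L w.
rewrite ltW// (lt_le_trans (grid_point_lt n (s0 w)))// lerD//.
by rewrite invf_le1 ?ltr0n// ler1n.
Qed.

(** Exactly one cell contains [w]. This writes a value at the random index as a finite sum, which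
    can be integrated term by term. *)
Let sum_cells n (F : nat -> R) w :
  \sum_(k < cells n) F k * \1_(cell n k) w = F (grid_index n (s w)).
Proof.
rewrite (bigD1 (Ordinal (cell_lt n w)))//= big1 ?addr0; last first.
  move=> k kw; rewrite indicE memNset ?mulr0// => /= wk; move/eqP: kw; apply.
  exact/val_inj.
by rewrite indicE mem_set// mulr1.
Qed.

Let A_cell n k : A (k%:R / n.+1%:R) (cell n k).
Proof. exact: grid_index_event. Qed.

Let A_measurable n k B : A (k%:R / n.+1%:R) B -> measurable B.
Proof. by have [/(_ _ (grid_time_ge0 n k))[_ +] _] := filtrationA; apply. Qed.

Let indic_le1 (B : set T) w : `|\1_B w| <= 1 :> R.
Proof. by rewrite indicE; case: (_ \in _); rewrite ?normr1 ?normr0. Qed.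

Let integrable_gridM n : P.-integrable setT (EFin \o gridM n).
Proof.
have -> : gridM n =
    (fun w => \sum_(k < cells n) M (k%:R / n.+1%:R) w * \1_(cell n k) w).
  by apply/funext => w; rewrite (sum_cells n (fun k => M (k%:R / n.+1%:R) w)).
apply: integrable_sumr => // k.
apply: (@integrableM_bounded _ _ _ _ _ _ 1) => //; first exact: integrableM.
by apply: measurable_indic; exact: (A_measurable (A_cell n k)).
Qed.

(** On the cell [k] the discretised value is [M (t k)], so the test function splits into the pieces
    [h k]. Each is bounded by 1 and known at time [t k], hence orthogonal to the increment of [M]
    from [t k] to [L + 1]. *)
Let gridM_orthogonal n : orthogonal_residual P (M (L + 1)) (gridM n).
Proof.
move=> g mg g1.
pose t k : R := k%:R / n.+1%:R.
pose h k w := \1_(cell n k) w * g (M (t k) w).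
have h1 k w : `|h k w| <= 1.
  by rewrite normrM mulr_ile1.
have mh k : measurable_wrt (A (t k)) (h k).
  have [/(_ _ (grid_time_ge0 n k))[sA _] _] := filtrationA.
  apply/measurable_wrtP => //; apply: measurable_funM.
    apply: measurable_indic; apply: sub_sigma_algebra; exact: A_cell.
  apply: (measurableT_comp mg); apply/measurable_wrtP => //.
  exact: (adaptedM (grid_time_ge0 n k)).
have hm k : measurable_fun setT (h k).
  have [/(_ _ (grid_time_ge0 n k))[_ Am] _] := filtrationA.
  exact: measurable_wrt_fun (mh k).
have -> : \int[P]_w ((M (L + 1) w - gridM n w) * g (gridM n w)) =
    \int[P]_w \sum_(k < cells n) (M (L + 1) w - M (t k) w) * h k w.
  apply: eq_Rintegral => w _.
  rewrite -[LHS](sum_cells n (fun k => (M (L + 1) w - M (t k) w) * g (M (t k) w))).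
  by apply: eq_bigr => k _; rewrite /h mulrA mulrAC.
rewrite Rintegral_sumr//.
  apply: big1 => k _.
  exact: martingale_orthogonal (grid_time_ge0 n k) (grid_time_le k) (mh k) (h1 k).
move=> k; apply: (@integrableM_bounded _ _ _ _ _ _ 1) => //.
by apply: integrableBr; apply: integrableM => //; exact: grid_time_ge0.
Qed.

Lemma optional_stopping :
  P.-integrable setT (EFin \o (fun w => M (s w) w)) /\
  \int[P]_w M (s w) w = \int[P]_w M (L + 1) w.
Proof.
apply: (orthogonal_residual_limit (integrableM L1_ge0) integrable_gridM).
  exact: gridM_orthogonal.
move=> w; apply: (@cvg_grid_point _ (M ^~ w)) => //.
by have [[_ _ +] _] := martingaleM; apply.
Qed.

End optional_stopping.

(** * Measurability of the stopped process, including the value at infinity *)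

Section measurability_of_stopped.
Context {d : measure_display} {T : measurableType d} {R : realType}.
Implicit Types (X : R -> T -> R) (tau : T -> \bar R).

(* Right-continuity reduces the infimum over [n, oo) to the one over a
   countable set. *)
Lemma inf_tail_grid X w n : right_continuous_paths X ->
  einfs (fun N => einfs (fun k =>
    (X (Num.max n%:R (k%:R / N.+1%:R)) w)%:E) 0%N) 0%N =
  ereal_inf ((fun t => (X t w)%:E) @` `[n%:R, +oo[).
Proof.
move=> cX; apply/eqP; rewrite eq_le; apply/andP; split.
- apply/ereal_infP => _ [t /= + <-]; rewrite in_itv /= andbT => nt.
  have t0 : 0 <= t by rewrite (le_trans _ nt).
  have ct : (X (grid_point N t) w)%:E @[N --> \oo] --> (X t w)%:E.
    apply: cvg_EFin; first exact: nearW.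
    by apply: (@cvg_grid_point _ (X ^~ w)) => //; exact: cX.
  rewrite -(cvg_lim _ ct)//; apply: lime_ge; first exact: cvgP ct.
  apply: nearW => N; apply: ge_ereal_inf.
  exists (einfs (fun k => (X (Num.max n%:R (k%:R / N.+1%:R)) w)%:E) 0%N).
    by exists N.
  apply: ereal_inf_lbound; exists (grid_index N t) => //=.
  rewrite -/(grid_point N t) max_r// (le_trans nt)//; exact: grid_point_ge.
- apply/ereal_infP => _ [N _ <-]; apply/ereal_infP => _ [k _ <-].
  apply: ereal_inf_lbound; exists (Num.max n%:R (k%:R / N.+1%:R)) => //=.
  by rewrite in_itv /= andbT le_max lexx.
Qed.

(** The tails [[n, +oo[] with [n] natural are cofinal among the neighbourhoods of infinity. The
    lower limit thus becomes a combination of countable suprema and infima, which preserve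
    measurability. *)
Lemma at_infinity_grid X w : right_continuous_paths X ->
  at_infinity X w = esups (fun n => einfs (fun N => einfs (fun k =>
    (X (Num.max n%:R (k%:R / N.+1%:R)) w)%:E) 0%N) 0%N) 0%N.
Proof.
move=> cX; rewrite /at_infinity limf_einfE.
under [in RHS]eq_fun do rewrite inf_tail_grid//.
apply/eqP; rewrite eq_le; apply/andP; split.
- apply/ereal_supP => _ [V [M [_ MV]] <-].
  pose n := (Num.truncn M).+1; apply: le_ereal_sup_tmp.
  exists (ereal_inf ((fun t => (X t w)%:E) @` `[n%:R, +oo[)); first by exists n.
  apply: ereal_inf_le_tmp => _ [t /= + <-]; rewrite in_itv /= andbT => nt.
  by exists t => //; apply: MV; rewrite (lt_le_trans _ nt)// truncnS_gt.
- apply/ereal_supP => _ [n _ <-]; apply: ereal_sup_ubound.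
  exists `[n%:R, +oo[%classic => //; exists n%:R; split; first exact: num_real.
  by move=> x nx; rewrite /= in_itv /= andbT ltW.
Qed.

Lemma measurable_at_infinity X :
  (forall t, 0 <= t -> measurable_fun setT (X t)) ->
  right_continuous_paths X -> measurable_fun setT (at_infinity X).
Proof.
move=> mX cX; rewrite (funext (fun w => at_infinity_grid w cX)).
apply: measurable_fun_esups => n; apply: measurable_fun_einfs => N.
apply: measurable_fun_einfs => k; apply/measurable_EFinP.
by apply: mX; rewrite le_max ler0n.
Qed.

Lemma measurable_stopped X tau :
  (forall t, 0 <= t -> measurable_fun setT (X t)) ->
  right_continuous_paths X -> measurable_fun setT tau ->
  (forall w, (0 <= tau w)%E) ->
  measurable_fun setT (stopped X tau).
Proof.
move=> mX cX mtau tau0.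
(* Where [tau w = +oo], [fine (tau w)] defaults to 0; the test discards that value. *)
have -> : stopped X tau = (fun w => if tau w == +oo%E then at_infinity X w
    else (X (fine (tau w)) w)%:E).
  by apply/funext => w; rewrite /stopped; have := tau0 w; case: (tau w).
apply: measurable_fun_ifT.
- exact: measurable_fun_eqe.
- exact: measurable_at_infinity.
- apply/measurable_EFinP; apply: (@measurable_fun_at_time _ _ _ X) => //.
    by move=> w; exact: fine_ge0.
  move=> t _; have mf : measurable_fun setT (fine \o tau).
    by apply: measurableT_comp mtau; exact: fine_measurable.
  have := mf measurableT _ (measurable_itv `]-oo, t]); rewrite setTI.
  by congr (measurable _); apply/seteqP; split => w /=; rewrite in_itv.
Qed.

Lemma measurable_stopping_time (A : R -> set (set T)) tau :
  filtration A -> stopping_time A tau -> measurable_fun setT tau.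
Proof.
move=> [FA _] [tau0 Atau] mT; apply: (measurability _ (ErealGenOInfty.measurableE R)) => //.
move=> _ [_ [x ->] <-]; rewrite setTI.
(* The filtration constrains [tau] only at nonnegative levels; above a negative level the preimage
   is the whole space. *)
have [x0|x0] := ltP x 0.
  rewrite [X in measurable X](_ : _ = setT) //; apply/seteqP; split => // w _ /=.
  by rewrite in_itv /= andbT (lt_le_trans _ (tau0 w))// lte_fin.
rewrite -[X in measurable X]setCK; apply: measurableC.
rewrite [X in measurable X](_ : _ = [set w | (tau w <= x%:E)%E]).
  by have [_] := FA x x0; apply; exact: Atau.
apply/seteqP; split => w /=; rewrite in_itv /= andbT.
  by move/negP; rewrite -leNgt.
by move=> h; apply/negP; rewrite -leNgt.
Qed.

End measurability_of_stopped.

(** * Pathwise Lebesgue-Stieltjes integrals of an integrand that changes sign once *)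

Section stieltjes_integral.
Context {R : realType}.
Variables (F : cumulative R R) (y : R -> R).
Local Notation mu := (lebesgue_stieltjes_measure F).

Lemma lebesgue_stieltjes_measure_itvoc (a b : R) : a <= b ->
  mu `]a, b]%classic = (F b - F a)%:E.
Proof.
move=> ab; rewrite /lebesgue_stieltjes_measure /measure_extension /=.
by rewrite measurable_mu_extE/= ?wlength_itv_bnd//; exact: is_ocitv.
Qed.

(** For every [s < t] the point lies in []s, t]], whose mass [F t - F s] vanishes as [s] tends to
    [t] from the left. *)
Lemma lebesgue_stieltjes_measure_set1 (t : R) :
  F s @[s --> t^'-] --> F t -> mu [set t] = 0%E.
Proof.
move=> Ft; apply/eqP; rewrite eq_le measure_ge0 andbT.
have cF : (F t - F s)%:E @[s --> t^'-] --> 0%:E.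
  apply: cvg_EFin; first exact: nearW.
  by rewrite -[X in _ --> X](subrr (F t)); apply: cvgB => //; exact: cvg_cst.
rewrite -[leRHS]/(0%:E) -(cvg_lim _ cF)//; apply: lime_ge; first exact: cvgP cF.
near=> s; have st : s < t by near: s; exact: nbhs_left_lt.
rewrite -(lebesgue_stieltjes_measure_itvoc (ltW st)); apply: le_measure.
- by rewrite inE; exact: measurable_set1.
- by rewrite inE; exact: measurable_itv.
- by move=> _ ->; rewrite /= in_itv /= st lexx.
Unshelve. all: by end_near. Qed.

Hypothesis integrable_y : forall t, 0 <= t ->
  mu.-integrable `]0, t] (fun s => (y s)%:E).

Lemma Rintegral_increment (a b : R) : 0 <= a -> a <= b ->
  \int[mu]_(s in `]0, b]) y s =
  \int[mu]_(s in `]0, a]) y s + \int[mu]_(s in `]a, b]) y s.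
Proof.
move=> a0 ab; have E : `]0, b]%classic = `]0, a] `|` `]a, b].
  by rewrite -itv_bndbnd_setU// bnd_simp.
rewrite E Rintegral_setU//; try exact: measurable_itv.
- by rewrite -E; apply: integrable_y; exact: le_trans ab.
- apply/disj_setPS => s [] /=; rewrite !in_itv /= => /andP[_ sa] /andP[as_ _].
  by move: (le_lt_trans sa as_); rewrite ltxx.
Qed.

(** The interval contains [b], but the sign of [y] is given only before [b]: at the myopic time
    itself the integrand may already be negative. Either [b] carries no mass, or [y b] is a left
    limit of nonnegative values. *)
Lemma Rintegral_ioc_ge0 (a b : R) : 0 <= a -> a < b ->
  (forall s, a < s -> s < b -> 0 <= y s) ->
  F s @[s --> b^'-] --> F b \/ y s @[s --> b^'-] --> y b ->
  0 <= \int[mu]_(s in `]a, b]) y s.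
Proof.
move=> a0 ab y0 [/lebesgue_stieltjes_measure_set1 Fb|yb].
  rewrite /Rintegral (@negligible_integral _ _ _ mu _ [set b])//.
  - apply: fine_ge0; apply: integral_ge0 => s [/=].
    rewrite in_itv /= => /andP[as_ sb] /eqP nsb.
    by rewrite lee_fin y0// lt_neqAle nsb.
  - apply: integrableS (integrable_y (le_trans a0 (ltW ab))) => //.
    by move=> s /=; rewrite !in_itv /= => /andP[/(le_lt_trans a0) -> ->].
have yb0 : 0 <= y b.
  rewrite -(cvg_lim _ yb)//; apply: limr_ge; first exact: cvgP yb.
  near=> s; apply: y0; near: s; first exact: nbhs_left_gt.
  exact: nbhs_left_lt.
apply: Rintegral_ge0 => s /=; rewrite in_itv /= => /andP[as_].
by rewrite le_eqVlt => /predU1P[->//|]; exact: y0.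
Unshelve. all: by end_near. Qed.

Lemma Rintegral_ioc_le0 (a b : R) :
  (forall s, a < s -> s <= b -> y s <= 0) ->
  \int[mu]_(s in `]a, b]) y s <= 0.
Proof.
move=> y0.
have y0' s : `]a, b]%classic s -> (0 <= - (y s)%:E)%E.
  by rewrite /= in_itv /= => /andP[? ?]; rewrite lee_fin oppr_ge0 y0.
(* The integral of [- y] is nonnegative, and [fine] preserves this even at [+oo], which it sends to
   0. *)
rewrite /Rintegral; under eq_integral do rewrite -[(y _)%:E]oppeK.
rewrite integral_ge0N// fineN oppr_le0; apply: fine_ge0.
exact: integral_ge0.
Qed.

(** The indefinite integral rises up to [theta] and falls afterwards, so on [[0, L]] it is largest
    at the minimum of [theta] and [L]. *)
Lemma Rintegral_unimodal (theta : \bar R) (a L : R) : (0 <= theta)%E ->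
  (forall s, 0 <= s -> (s%:E < theta)%E -> 0 <= y s) ->
  (forall s, 0 <= s -> (theta < s%:E)%E -> y s <= 0) ->
  (forall t, 0 < t ->
    F s @[s --> t^'-] --> F t \/ y s @[s --> t^'-] --> y t) ->
  0 <= a -> a <= L ->
  \int[mu]_(s in `]0, a]) y s <=
  \int[mu]_(s in `]0, fine (mine theta L%:E)]) y s.
Proof.
move=> theta0 ypos yneg jump a0 aL; set b := fine _.
have bE : b%:E = mine theta L%:E.
  rewrite fineK// fin_numE; apply/andP; split.
    by rewrite gt_eqF// lt_min ltNyr (lt_le_trans _ theta0)// ltNy0.
  by rewrite lt_eqF// gt_min ltry orbT.
have [ab|ba] := leP a b.
  rewrite (Rintegral_increment a0 ab) lerDl.
  move: ab; rewrite le_eqVlt => /predU1P[->|ab].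
    by rewrite set_itvoc0 Rintegral_set0.
  apply: Rintegral_ioc_ge0 => //; last by apply: jump; exact: le_lt_trans ab.
  move=> s as_ sb; apply: ypos; first by rewrite (le_trans a0)// ltW.
  have : (s%:E < b%:E)%E by rewrite lte_fin.
  by rewrite bE lt_min => /andP[].
(* Since [b < a <= L], the minimum is not [L]; so [b] is [theta], and [y <= 0] on []b, a]]. *)
have thetab : theta = b%:E.
  rewrite bE; apply/esym/min_idPl; rewrite leNgt; apply/negP => Lt.
  have bL : b%:E = L%:E by rewrite bE; apply/min_idPr; exact: ltW.
  by move: ba; case: bL => ->; rewrite ltNge aL.
have b0 : 0 <= b by rewrite -lee_fin -thetab.
rewrite (Rintegral_increment b0 (ltW ba)) gerDl.
apply: Rintegral_ioc_le0 => s bs _; apply: yneg.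
  by rewrite (le_trans b0)// ltW.
by rewrite thetab lte_fin.
Qed.

End stieltjes_integral.

(** * Extended-valued integrals of functions that may fail to be integrable *)

Section integral_comparison.
Context {d : measure_display} {T : measurableType d} {R : realType}.
Variable mu : {measure set T -> \bar R}.
Local Open Scope ereal_scope.

(* No integrability is needed because [+oo - +oo = -oo]. *)
Lemma ae_le_integral (f g : T -> \bar R) :
  measurable_fun setT f -> measurable_fun setT g ->
  {ae mu, forall w, f w <= g w} -> \int[mu]_w f w <= \int[mu]_w g w.
Proof.
move=> mf mg fg; rewrite integralE [leRHS]integralE; apply: leeB.
- apply: ae_ge0_le_integral => //; [exact: measurable_funepos..|].
  by apply: filterS fg => w fgw _; rewrite !funeposE ge_max !le_max fgw lexx orbT.
- apply: ae_ge0_le_integral => //; [exact: measurable_funeneg..|].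
  by apply: filterS fg => w fgw _; rewrite !funenegE ge_max !le_max leeN2 fgw lexx orbT.
Qed.

(** Adding [-oo] always yields [-oo], so an infinite negative part would force the integral of [f]
    to be [-oo]. *)
Lemma integral_funeneg_ltNy (f : T -> \bar R) :
  -oo < \int[mu]_w f w -> \int[mu]_w f^\- w < +oo.
Proof.
rewrite integralE; have [//|] := eqVneq (\int[mu]_w f^\- w) +oo; last first.
  by rewrite ltey.
by move=> ->; rewrite addeNy ltxx.
Qed.

Lemma integral_nonintegrable (f : T -> \bar R) : measurable_fun setT f ->
  \int[mu]_w f^\- w < +oo -> ~ mu.-integrable setT f -> \int[mu]_w f w = +oo.
Proof.
move=> mf fn nf; rewrite integralE.
have fp : \int[mu]_w f^\+ w = +oo.
  apply/eqP; rewrite -leye_eq leNgt; apply/negP => fp; apply: nf.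
  apply/integrableP; split => //.
  rewrite (_ : (fun w => `|f w|) = f^\+ \+ f^\-); last exact: fune_abse.
  rewrite ge0_integralD//; [|exact: measurable_funepos|exact: measurable_funeneg].
  exact: lte_add_pinfty.
by rewrite fp addye// gt_eqF// lteNr.
Qed.

End integral_comparison.

(** * Monotone case and optimality for a single process with non-increasing [Y] *)

Section myopic_rule.
Context {d : measure_display} {T : measurableType d} {R : realType}.
Variables (P : probability T R) (A : R -> set (set T)).
Variables (X M Y : R -> T -> R) (V : T -> cumulative R R).
Hypothesis filtrationA : filtration A.
Hypothesis doob_meyerX : doob_meyer A P X M Y V.
Hypothesis Y_nonincreasing : forall w (s t : R),
  0 <= s -> s <= t -> Y t w <= Y s w.
Let tau := myopic_time Y.

Lemma myopic_time_ge0 w : (0 <= tau w)%E.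
Proof. by apply/ereal_infP => _ [t [t0 _] <-]; rewrite lee_fin. Qed.

Lemma gt0_before_myopic_time w (s : R) : 0 <= s -> (s%:E < tau w)%E -> 0 < Y s w.
Proof.
move=> s0 st; rewrite ltNge; apply/negP => Ys.
move: st; rewrite ltNge => /negP; apply.
by apply: ereal_inf_lbound; exists s.
Qed.

Lemma le0_after_myopic_time w (t : R) : (tau w < t%:E)%E -> Y t w <= 0.
Proof.
move=> /ereal_inf_lt[_ [s [s0 Ys] <-]]; rewrite lte_fin => st.
by apply: le_trans Ys; apply: Y_nonincreasing => //; exact: ltW.
Qed.

Lemma doob_meyer_monotone_case : monotone_case A P X M Y V.
Proof. by split => // w t _; exact: le0_after_myopic_time. Qed.

Hypothesis jumps : left_continuous_at_jumps Y V.

Let XI t : 0 <= t -> P.-integrable setT (EFin \o X t).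
Proof. by move=> t0; have [[_ + _] _ _ _ _] := doob_meyerX; apply. Qed.

Let mX t : 0 <= t -> measurable_fun setT (X t).
Proof. by move=> t0; exact: measurable_integrable (XI t0). Qed.

Let cX : right_continuous_paths X.
Proof. by have [[_ _ +] _ _ _ _] := doob_meyerX. Qed.

Let martingaleM : martingale A P M.
Proof. by have [_ [+ _] _ _ _] := doob_meyerX. Qed.

Let integrableM_at_time t : 0 <= t -> P.-integrable setT (EFin \o M t).
Proof. by move=> t0; have [[_ + _] _] := martingaleM; apply. Qed.

Let M0 t : 0 <= t -> \int[P]_w M t w = 0.
Proof.
move=> t0; have [_ [_ /(_ t t0) + ] _ _ _] := doob_meyerX.
by rewrite unlock /Rintegral => ->.
Qed.

Definition bounded_by (L : R) (sigma : T -> \bar R) :=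
  forall w, (sigma w <= L%:E)%E.

Let fineK_bounded L sigma w : stopping_time A sigma -> bounded_by L sigma ->
  (fine (sigma w))%:E = sigma w.
Proof.
move=> [s0 _] sL; apply: fineK; rewrite ge0_fin_numE//.
by rewrite (le_lt_trans (sL w))// ltry.
Qed.

Lemma stopped_bounded Z L sigma : stopping_time A sigma -> bounded_by L sigma ->
  stopped Z sigma = EFin \o (fun w => Z (fine (sigma w)) w).
Proof.
by move=> ss sL; apply/funext => w; rewrite /stopped -(fineK_bounded w ss sL).
Qed.

Lemma stopped_martingale L sigma : stopping_time A sigma -> bounded_by L sigma ->
  P.-integrable setT (EFin \o (fun w => M (fine (sigma w)) w)) /\
  \int[P]_w M (fine (sigma w)) w = 0.
Proof.
move=> ss sL; have [s0 As] := ss.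
have sL' w : 0 <= fine (sigma w) <= L.
  by rewrite fine_ge0//= -lee_fin (fineK_bounded w ss sL).
have As' t : 0 <= t -> A t [set w | fine (sigma w) <= t].
  move=> t0; have := As t t0; congr (A t _); apply/seteqP.
  by split => w /=; rewrite -lee_fin (fineK_bounded w ss sL).
have [IM ->] := optional_stopping filtrationA martingaleM sL' As'.
split=> //; apply: M0; have /andP[a b] := sL' point.
by rewrite addr_ge0// (le_trans a).
Qed.

Hypothesis stopping_tau : stopping_time A tau.

Definition truncated_myopic (L : R) w := mine (tau w) L%:E.

Lemma stopping_truncated L : 0 <= L -> stopping_time A (truncated_myopic L).
Proof.
move=> L0; have [t0 At] := stopping_tau; split=> [w|t tt0].
  by rewrite le_min t0 lee_fin.
have [/(_ t tt0)[sA _] _] := filtrationA.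
have [Lt|tL] := leP L t.
  rewrite (_ : [set w | _] = setT).
    by case: sA => A0 sC _; rewrite -(setD0 setT); exact: sC.
  by apply/seteqP; split => // w _ /=; rewrite ge_min lee_fin Lt orbT.
rewrite (_ : [set w | _] = [set w | (tau w <= t%:E)%E]); first exact: At.
by apply/seteqP; split => w /=; rewrite ge_min [(L%:E <= _)%E]leNgt lte_fin tL orbF.
Qed.

Lemma truncated_bounded L : bounded_by L (truncated_myopic L).
Proof. by move=> w; rewrite ge_min lexx orbT. Qed.

(** Both differences equal [X 0] plus a path integral, and the path integral is unimodal with its
    peak at [tau]. The exceptional null set of the decomposition serves all times at once, so random
    times may be inserted. *)
Lemma pathwise_comparison L sigma : stopping_time A sigma -> bounded_by L sigma ->
  {ae P, forall w,
    X (fine (sigma w)) w - M (fine (sigma w)) w <=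
    X (fine (truncated_myopic L w)) w - M (fine (truncated_myopic L w)) w}.
Proof.
move=> ss sL; have [_ _ _ _] := doob_meyerX; apply: filterS => w dm.
have s0 : 0 <= fine (sigma w) by apply: fine_ge0; case: ss.
have sLw : fine (sigma w) <= L by rewrite -lee_fin (fineK_bounded w ss sL).
have b0 : 0 <= fine (truncated_myopic L w).
  by apply: fine_ge0; rewrite le_min myopic_time_ge0 lee_fin (le_trans s0).
have [_ ->] := dm _ s0; have [_ ->] := dm _ b0.
rewrite -!addrA ![M _ w + _]addrC !subrK lerD2l.
apply: Rintegral_unimodal => //.
- by move=> t t0; have [] := dm t t0.
- exact: myopic_time_ge0.
- by move=> s ? /gt0_before_myopic_time => /(_ _)/ltW; apply.
- by move=> s _; exact: le0_after_myopic_time.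
- by move=> t t0; exact: jumps.
Qed.

Lemma measurable_stopped_X sigma : stopping_time A sigma ->
  measurable_fun setT (stopped X sigma).
Proof.
move=> ss; apply: measurable_stopped => //; last by case: ss.
exact: measurable_stopping_time ss.
Qed.

Lemma truncated_myopic0 w : truncated_myopic 0 w = 0%E.
Proof. by rewrite /truncated_myopic min_r// myopic_time_ge0. Qed.

(** A finite starting value for the nondecreasing means, which keeps their limit away from [-oo]. *)
Lemma mean_stopped0 : mean_stopped P X (truncated_myopic 0) \is a fin_num.
Proof.
have -> : mean_stopped P X (truncated_myopic 0) = (\int[P]_w (X 0 w)%:E)%E.
  by apply: eq_integral => w _; rewrite /stopped truncated_myopic0.
exact: (integrable_fin_num measurableT (XI (lexx 0))).
Qed.

(** Comparison with the stopping time 0 bounds the stopped value from below by [X 0 - M 0] plus the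
    stopped martingale, which is integrable. *)
Lemma truncated_myopic_funeneg L : 0 <= L ->
  (\int[P]_w (stopped X (truncated_myopic L))^\- w < +oo)%E.
Proof.
move=> L0; have st := stopping_truncated L0; have tL := @truncated_bounded L.
have [IMt _] := stopped_martingale st tL.
have s0 := stopping_truncated (lexx 0).
have s0L : bounded_by L (truncated_myopic 0).
  by move=> w; rewrite truncated_myopic0 lee_fin.
have IM0 := integrableM_at_time (lexx 0).
have IB := integrableD measurableT (integrableBr (XI (lexx 0)) IM0) IMt.
apply: integral_funeneg_ltNy.
apply: (lt_le_trans _ (ae_le_integral (measurable_int _ IB)
  (measurable_stopped_X st) _)).
  by rewrite ltNye_eq (integrable_fin_num measurableT IB).
have := pathwise_comparison s0 s0L; apply: filterS => w.
rewrite truncated_myopic0 (stopped_bounded X st tL) /= -EFinD lee_fin.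
lra.
Qed.

Lemma mean_stopped_le_truncated L sigma : 0 <= L ->
  stopping_time A sigma -> bounded_by L sigma ->
  (mean_stopped P X sigma <= mean_stopped P X (truncated_myopic L))%E.
Proof.
move=> L0 ss sL; have st := stopping_truncated L0; have tL := @truncated_bounded L.
have [IMs Ms0] := stopped_martingale ss sL.
have [IMt Mt0] := stopped_martingale st tL.
have mXs := measurable_stopped_X ss; have mXt := measurable_stopped_X st.
(* Without integrability the right-hand mean is [+oo], as its negative part is finite. *)
have [It|nIt] := pselect (P.-integrable setT (stopped X (truncated_myopic L))); last first.
  rewrite /mean_stopped [leRHS]integral_nonintegrable ?leey//.
  exact: truncated_myopic_funeneg.
have IMB := integrableBr IMs IMt.
have MB0 : (\int[P]_w (M (fine (sigma w)) w
    - M (fine (truncated_myopic L w)) w)%:E = 0)%E.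
  rewrite -[LHS](fineK (integrable_fin_num measurableT IMB)).
  rewrite -[fine _]/(Rintegral _ _ _) RintegralB// Ms0 Mt0.
  by rewrite subrr.
(* Adding the difference of the stopped martingales, of mean 0, to the right-hand side reduces the
   claim to the pathwise comparison. *)
rewrite /mean_stopped -[leRHS]adde0 -MB0 -integralD//.
apply: ae_le_integral => //.
  by apply: emeasurable_funD => //; exact: measurable_int IMB.
have := pathwise_comparison ss sL; apply: filterS => w.
rewrite (stopped_bounded X ss sL) (stopped_bounded X st tL) /= -EFinD lee_fin.
lra.
Qed.

(** The time truncated at [L] is itself a competitor bounded by [K]. *)
Lemma mean_truncated_nondecreasing : {in Num.nneg &,
  {homo (fun L => mean_stopped P X (truncated_myopic L)) : L K / L <= K >-> (L <= K)%E}}.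
Proof.
move=> L K; rewrite !nnegrE => L0 K0 LK; apply: mean_stopped_le_truncated => //.
  exact: stopping_truncated.
by move=> w; rewrite (le_trans (truncated_bounded _ _))// lee_fin.
Qed.

Lemma mean_truncated_le_lim L : 0 <= L ->
  (mean_stopped P X (truncated_myopic L) <=
   lim (mean_stopped P X (truncated_myopic K) @[K --> +oo%R]))%E.
Proof.
(* Freezing the horizon at 0 for negative [K] gives a function that is monotone on the whole line
   and has the same limit at infinity. *)
move=> L0; pose phi K := mean_stopped P X (truncated_myopic (Num.max 0 K)).
have ndphi : nondecreasing_fun phi.
  move=> K K' KK'; apply: mean_truncated_nondecreasing.
  - by rewrite nnegrE le_max lexx.
  - by rewrite nnegrE le_max lexx.
  - by rewrite ge_max !le_max lexx KK' orbT.
have cphi := nondecreasing_cvge ndphi.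
have : mean_stopped P X (truncated_myopic K) @[K --> +oo%R] --> ereal_sup (range phi).
  apply: cvg_trans cphi; apply: near_eq_cvg; near=> K.
  by rewrite /phi max_r//; near: K; exact: nbhs_pinfty_ge.
move=> /cvg_lim ->//; apply: ereal_sup_ubound; exists L => //.
by rewrite /phi max_r.
Unshelve. all: by end_near. Qed.

Lemma myopic_optimal :
  (lim (mean_stopped P X (truncated_myopic L) @[L --> +oo%R])
    <= mean_stopped P X tau)%E ->
  sup_mean_bounded A P X = sup_mean A P X -> optimal A P X tau.
Proof.
move=> limle supE.
(* The mean at [tau] dominates the limit and hence [E X_0]. Being above [-oo], it has a finite
   negative part, so [tau] is admissible in the supremum. *)
have tauNy : (-oo < mean_stopped P X tau)%E.
  apply: lt_le_trans limle; apply: lt_le_trans (mean_truncated_le_lim (lexx 0)).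
  by rewrite ltNye_eq mean_stopped0.
have ex : mean_exists P X tau.
  split; first exact: measurable_stopped_X.
  by right; exact: integral_funeneg_ltNy.
split => //; apply/eqP; rewrite eq_le; apply/andP; split.
  by apply: ereal_sup_ubound; exists tau.
rewrite -supE; apply/ereal_supP => _ [sigma [ss [L sL] _] <-].
apply: le_trans limle.
(* The bound [L] is replaced by a larger one that is visibly nonnegative. *)
have L0 : 0 <= Num.max 0 L by rewrite le_max lexx.
apply: le_trans (mean_truncated_le_lim L0).
apply: mean_stopped_le_truncated => // w.
by rewrite (le_trans (sL w))// lee_fin le_max lexx orbT.
Qed.

End myopic_rule.

(** * Passage from the summands to their sum *)

Lemma left_continuous_at_jumps_sum {d : measure_display} {T : measurableType d}
    {R : realType} (m : nat) (Y : 'I_m -> R -> T -> R) (V : T -> cumulative R R) :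
  (forall i, left_continuous_at_jumps (Y i) V) ->
  left_continuous_at_jumps (fun t w => \sum_(i < m) Y i t w) V.
Proof.
(* Whether [V] jumps at [t] does not depend on [i]; at a jump every [Y i] is left-continuous, hence
   so is the sum. *)
move=> jY w t t0; have [Vt|nVt] := pselect (V w s @[s --> t^'-] --> V w t).
  by left.
right; apply: cvg_big => [|i _]; first exact: add_continuous.
by have [] := jY i w t t0.
Qed.

Theorem proposition3p2 (R : realType) (d : measure_display)
  (T : measurableType d) (P : probability T R) (m : nat) (m_gt0 : (0 < m)%N)
  (A : R -> set (set T)) (X M Y : 'I_m -> R -> T -> R)
  (V : T -> cumulative R R)
  (filtrationA : filtration A)
  (doob_meyerX : forall i, doob_meyer A P (X i) (M i) (Y i) V)
  (Y_nonincreasing : forall i w (s t : R),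
     0 <= s -> s <= t -> Y i t w <= Y i s w)
  (stopping_myopic :
     stopping_time A (myopic_time (fun t w => \sum_(i < m) Y i t w))) :
  let sumX := fun t w => \sum_(i < m) X i t w in
  let sumM := fun t w => \sum_(i < m) M i t w in
  let sumY := fun t w => \sum_(i < m) Y i t w in
  let tau := myopic_time sumY in
  monotone_case A P sumX sumM sumY V /\
  ((forall i, left_continuous_at_jumps (Y i) V) ->
   (lim (mean_stopped P sumX (fun w => mine (tau w) L%:E) @[L --> +oo%R])
      <= mean_stopped P sumX tau)%E ->
   sup_mean_bounded A P sumX = sup_mean A P sumX ->
   optimal A P sumX tau).
Proof.
move=> sumX sumM sumY tau.
have dm : doob_meyer A P sumX sumM sumY V by exact: doob_meyer_sum.
have nY w (s t : R) : 0 <= s -> s <= t -> sumY t w <= sumY s w.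
  by move=> s0 st; apply: ler_sum => i _; exact: Y_nonincreasing.
split; first exact: doob_meyer_monotone_case.
move=> jY; apply: (myopic_optimal filtrationA dm nY _ stopping_myopic).
exact: left_continuous_at_jumps_sum.
Qed.
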